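(* Let $p=3$, $\theta\in\mathcal{E}_3$, $q\in\mathbb{Q}_3$ with $0<|\theta-1|_3<|q|_3<1$, and $f=f_{\theta,q,3}$. (i) If $|q|_3=\frac13$, then $\mathfrak{B}(\mathbf{x}^{(0)})=\mathbb{Q}_3\setminus\bigcup_{n=0}^{+\infty}f^{-n}\{\mathbf{x}^{(\infty)}\}$. (ii) If $|q|_3<\frac13$, then $\mathfrak{B}(\mathbf{x}^{(0)})=\mathbb{Q}_3\setminus\left(\{\mathbf{x}^{(1)}\}\cup\bigcup_{n=0}^{+\infty}f^{-n}\{\mathbf{x}^{(\infty)}\}\right)$.
   Context: $\mathcal{E}_3=\{x\in\mathbb{Q}_3:|x-1|_3<3^{-1/2}\}$. The Potts--Bethe mapping is $f_{\theta,q,3}(x)=\left(\frac{\theta x+q-1}{x+\theta+q-2}\right)^3$, defined on $\mathbb{Q}_3\setminus\{\mathbf{x}^{(\infty)}\}$, $\mathbf{x}^{(\infty)}=2-\theta-q$. For $S\subset\mathbb{Q}_3$, $n\ge0$, $f^{-n}(S)$ is the set of $x$ for which the iterate $f^n(x)$ is defined and lies in $S$ ($f^0$ the identity). $\mathbf{x}^{(0)}=1$ is a fixed point. When $|q|_3<\frac13$, the cubic $y^3-(1+\theta+\theta^2)y^2-(2\theta+1)(1-\theta-q)y-(1-\theta-q)^2=0$ has exactly one root $\mathbf{y}^{(1)}\in\mathbb{Q}_3$, and $\mathbf{x}^{(1)}=1-q+(\theta-1)(\mathbf{y}^{(1)}-1)$ is the other fixed point of $f$. $\mathfrak{B}(\mathbf{x}^{(0)})=\{x\in\mathbb{Q}_3:\lim_{n\to\infty}f^n(x)=\mathbf{x}^{(0)}\}$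 (all iterates defined). *)

(* Defs.v *)
From HB Require Import structures.
From mathcomp Require Import all_boot all_order all_algebra.
From mathcomp Require Import ring_quotient lra.
From mathcomp Require Import all_classical all_reals all_analysis.

Set Implicit Arguments.
Unset Strict Implicit.
Unset Printing Implicit Defensive.

Import Order.TTheory GRing.Theory Num.Theory.
Import numFieldNormedType.Exports.

Local Open Scope classical_set_scope.
Local Open Scope ring_scope.

Section RatPadicAbs.
Variable p : nat.

Definition rat_vp (r : rat) : int :=
  (logn p `|numq r|)%:Z - (logn p `|denq r|)%:Z.

(* Normalized by |p|_p = p^-1. *)
Definition rat_pabs (r : rat) : rat :=
  if r == 0 then 0 else p%:R ^ (- rat_vp r).

Hypothesis p_pr : prime p.

Let p_gt0 : 0 < p%:R :> rat. Proof. by rewrite ltr0n prime_gt0. Qed.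
Let p_gt1 : 1 < p%:R :> rat. Proof. by rewrite ltr1n prime_gt1. Qed.
Let p_neq0 : p%:R != 0 :> rat. Proof. by rewrite gt_eqF. Qed.

Lemma rat_vpE (a b : int) : a != 0 -> b != 0 ->
  rat_vp (a%:~R / b%:~R) = (logn p `|a|)%:Z - (logn p `|b|)%:Z.
Proof.
move=> a0 b0; set r := _ / _.
have r0 : r != 0 by rewrite mulf_neq0 ?invr_eq0 ?intr_eq0.
have : numq r * b = a * denq r.
  apply/eqP; rewrite -(eqr_int rat) !intrM; apply/eqP.
  have rE : r = (numq r)%:~R / (denq r)%:~R by rewrite divq_num_den.
  have -> : (numq r)%:~R = r * (denq r)%:~R :> rat.
    by rewrite {2}rE mulfVK// intr_eq0 denq_neq0.
  by rewrite mulrAC /r mulfVK// intr_eq0.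
move/(congr1 (fun z : int => logn p `|z|%N)).
rewrite !abszM !lognM ?absz_gt0 ?numq_eq0 ?denq_neq0// => e.
rewrite /rat_vp; apply/eqP; rewrite subr_eq addrAC eq_sym subr_eq.
by rewrite -!PoszD e addnC.
Qed.

Lemma rat_pabs0 : rat_pabs 0 = 0. Proof. by rewrite /rat_pabs eqxx. Qed.

Lemma rat_pabs_gt0 r : r != 0 -> 0 < rat_pabs r.
Proof. by move=> /negbTE r0; rewrite /rat_pabs r0 exprz_gt0. Qed.

Lemma rat_pabs_ge0 r : 0 <= rat_pabs r.
Proof.
have [->|/rat_pabs_gt0/ltW//] := eqVneq r 0.
by rewrite rat_pabs0.
Qed.

Lemma rat_pabs_eq0 r : (rat_pabs r == 0) = (r == 0).
Proof.
have [->|/rat_pabs_gt0 r0] := eqVneq r 0; first by rewrite rat_pabs0 eqxx.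
by rewrite gt_eqF.
Qed.

Lemma rat_vpM r s : r != 0 -> s != 0 -> rat_vp (r * s) = rat_vp r + rat_vp s.
Proof.
move=> r0 s0; rewrite -{1}(divq_num_den r) -{1}(divq_num_den s).
rewrite mulrACA -invfM -!intrM rat_vpE ?mulf_neq0 ?numq_eq0 ?denq_neq0//.
rewrite !abszM !lognM ?absz_gt0 ?numq_eq0 ?denq_neq0//.
by rewrite !PoszD opprD addrACA.
Qed.

Lemma rat_pabsM r s : rat_pabs (r * s) = rat_pabs r * rat_pabs s.
Proof.
have [->|r0] := eqVneq r 0; first by rewrite !(mul0r, rat_pabs0).
have [->|s0] := eqVneq s 0; first by rewrite !(mulr0, rat_pabs0).
rewrite /rat_pabs mulf_eq0 (negbTE r0) (negbTE s0)/=.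
by rewrite rat_vpM// opprD expfzDr.
Qed.

Lemma rat_pabsN r : rat_pabs (- r) = rat_pabs r.
Proof. by rewrite /rat_pabs /rat_vp oppr_eq0 numqN denqN abszN. Qed.

Lemma rat_pabs1 : rat_pabs 1 = 1.
Proof.
by rewrite /rat_pabs oner_eq0 /rat_vp /= logn1 subrr oppr0 expr0z.
Qed.

Lemma rat_pabsV r : rat_pabs r^-1 = (rat_pabs r)^-1.
Proof.
have [->|r0] := eqVneq r 0; first by rewrite !(rat_pabs0, invr0).
have r1 : rat_pabs r != 0 by rewrite rat_pabs_eq0.
by apply: (mulfI r1); rewrite -rat_pabsM !divff// rat_pabs1.
Qed.

Lemma rat_pabsB r s : rat_pabs (r - s) = rat_pabs (s - r).
Proof. by rewrite -opprB rat_pabsN. Qed.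

Lemma rat_pabs_max r s : rat_pabs (r + s) <= Num.max (rat_pabs r) (rat_pabs s).
Proof.
have [->|r0] := eqVneq r 0; first by rewrite add0r le_max lexx orbT.
have [->|s0] := eqVneq s 0; first by rewrite addr0 le_max lexx.
have [->|rs0] := eqVneq (r + s) 0; first by rewrite rat_pabs0 le_max rat_pabs_ge0.
pose a := numq r * denq s; pose b := numq s * denq r; pose d := denq r * denq s.
have a0 : a != 0 by rewrite mulf_neq0 ?numq_eq0 ?denq_neq0.
have b0 : b != 0 by rewrite mulf_neq0 ?numq_eq0 ?denq_neq0.
have d0 : d != 0 by rewrite mulf_neq0 ?denq_neq0.
have rE : r = a%:~R / d%:~R.
  rewrite -{1}(divq_num_den r) /a /d !intrM invfM mulrACA mulfV ?mulr1//.
  by rewrite intr_eq0 denq_neq0.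
have sE : s = b%:~R / d%:~R.
  rewrite -{1}(divq_num_den s) /b /d !intrM invfM.
  by rewrite (mulrC (_^-1)) mulrACA mulfV ?mulr1// intr_eq0 denq_neq0.
have rsE : r + s = (a + b)%:~R / d%:~R by rewrite rE sE -mulrDl intrD.
have ab0 : a + b != 0.
  by apply: contraNneq rs0; rewrite rsE => ->; rewrite mul0r.
rewrite /rat_pabs (negbTE r0) (negbTE s0) (negbTE rs0).
rewrite rsE rE sE !rat_vpE// le_max !ler_eXz2l// !lerN2 !lerD2r !lez_nat.
rewrite -geq_min; set k := minn _ _.
rewrite -pfactor_dvdn ?absz_gt0//.
have ka : ((p ^ k)%:Z %| a)%Z by rewrite dvdzE/= pfactor_dvdn ?absz_gt0// geq_minl.
have kb : ((p ^ k)%:Z %| b)%Z by rewrite dvdzE/= pfactor_dvdn ?absz_gt0// geq_minr.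
by have := rpredD ka kb; rewrite dvdzE.
Qed.

Lemma rat_pabs_lt r s (e : rat) : rat_pabs r < e -> rat_pabs s < e ->
  rat_pabs (r + s) < e.
Proof. by move=> re se; rewrite (le_lt_trans (rat_pabs_max r s))// gt_max re. Qed.

Lemma rat_pabsD r s : rat_pabs (r + s) <= rat_pabs r + rat_pabs s.
Proof.
by rewrite (le_trans (rat_pabs_max r s))// ge_max lerDl lerDr !rat_pabs_ge0.
Qed.

Lemma rat_pabs_dist r s : `|rat_pabs r - rat_pabs s| <= rat_pabs (r - s).
Proof.
rewrite ler_distl lerBlDr; apply/andP; split.
  by rewrite rat_pabsB addrC -{1}(subrK r s) rat_pabsD.
by rewrite addrC -{1}(subrK s r) rat_pabsD.
Qed.

End RatPadicAbs.

Section CauchySequences.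
Variables (p : nat) (p_pr : prime p).
Implicit Types u v w : nat -> rat.

(* Q_p is the ring of p-adic Cauchy sequences of rationals modulo the ideal of
   null sequences. The primality proof is an argument so that the algebraic
   instances, which need it, can be inferred from the type. *)
Definition cauchy_pred of prime p : {pred nat -> rat} := fun u =>
  `[< forall e : rat, 0 < e -> exists N : nat, forall m n : nat,
      (N <= m)%N -> (N <= n)%N -> rat_pabs p (u m - u n) < e >].
Local Notation cauchy := (cauchy_pred p_pr).

Lemma cauchyP u : reflect (forall e : rat, 0 < e -> exists N : nat,
    forall m n : nat, (N <= m)%N -> (N <= n)%N -> rat_pabs p (u m - u n) < e)
  (u \in cauchy).
Proof. exact: asboolP. Qed.

Lemma cauchy_bounded u : u \in cauchy ->
  exists2 B : rat, 0 < B & exists N : nat, forall n, (N <= n)%N ->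
    rat_pabs p (u n) < B.
Proof.
move=> /cauchyP/(_ 1 ltr01) [N uN].
exists (rat_pabs p (u N) + 1); first by rewrite ltr_wpDl// rat_pabs_ge0.
exists N => n Nn; rewrite -(subrK (u N) (u n)) rat_pabs_lt//.
  by rewrite (lt_le_trans (uN _ _ Nn _))// lerDr rat_pabs_ge0.
by rewrite ltrDl.
Qed.

Lemma cauchy_subring_closed : GRing.subring_closed cauchy.
Proof.
split=> [|u v /cauchyP uc /cauchyP vc|u v uc vc]; apply/cauchyP => e e0.
- by exists 0%N => m n _ _; rewrite subrr rat_pabs0.
- have [N uN] := uc _ e0; have [M vM] := vc _ e0.
  exists (maxn N M) => m n; rewrite !geq_max => /andP[Nm Mm] /andP[Nn Mn].
  have -> : (u - v) m - (u - v) n = (u m - u n) + (v n - v m).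
    rewrite [LHS](_ : _ = u m - v m - (u n - v n))//.
    by rewrite opprB addrACA [RHS]addrACA [- v m + _]addrC.
  by apply: rat_pabs_lt => //; [exact: uN|exact: vM].
- have [B B0 [N1 uB]] := cauchy_bounded uc.
  have [C C0 [N2 vC]] := cauchy_bounded vc.
  move/cauchyP : uc => /(_ (e / C)); rewrite divr_gt0// => /(_ isT) [N3 uN].
  move/cauchyP : vc => /(_ (e / B)); rewrite divr_gt0// => /(_ isT) [N4 vN].
  exists (maxn (maxn N1 N2) (maxn N3 N4)) => m n; rewrite !geq_max.
  move=> /andP[/andP[m1 m2] /andP[m3 m4]] /andP[/andP[n1 n2] /andP[n3 n4]].
  have -> : (u * v) m - (u * v) n = u m * (v m - v n) + (u m - u n) * v n.
    rewrite [LHS](_ : _ = u m * v m - u n * v n)//.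
    by rewrite mulrBr mulrBl addrA subrK.
  apply: rat_pabs_lt => //; rewrite rat_pabsM//.
    rewrite -(divfK (lt0r_neq0 B0) e) mulrC ltr_pM ?rat_pabs_ge0//.
      exact: vN.
    exact: uB.
  rewrite -(divfK (lt0r_neq0 C0) e) ltr_pM ?rat_pabs_ge0//.
    exact: uN.
  exact: vC.
Qed.

HB.instance Definition _ :=
  GRing.isSubringClosed.Build (nat -> rat) cauchy cauchy_subring_closed.

Record cauchy_seq := CauchySeq {
  cauchy_val :> nat -> rat;
  _ : cauchy_val \in cauchy }.

HB.instance Definition _ := [isSub for cauchy_val].
HB.instance Definition _ := [Choice of cauchy_seq by <:].
HB.instance Definition _ := [SubChoice_isSubComNzRing of cauchy_seq by <:].

Implicit Types x y : cauchy_seq.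

Definition null_pred : {pred cauchy_seq} := fun x =>
  `[< forall e : rat, 0 < e -> exists N : nat, forall n : nat,
      (N <= n)%N -> rat_pabs p (x n) < e >].

Lemma nullP x : reflect (forall e : rat, 0 < e -> exists N : nat,
    forall n : nat, (N <= n)%N -> rat_pabs p (x n) < e) (x \in null_pred).
Proof. exact: asboolP. Qed.

Lemma null_idealr_closed : idealr_closed null_pred.
Proof.
split.
- by apply/nullP => e e0; exists 0%N => n _; rewrite rat_pabs0.
- apply/nullP => /(_ 1 ltr01) [N /(_ N (leqnn N))].
  by rewrite rat_pabs1// ltxx.
- move=> a x y /nullP x0 /nullP y0; apply/nullP => e e0.
  have [B B0 [N1 aB]] := cauchy_bounded (valP a).
  have [|N2 xN] := x0 (e / B); first exact: divr_gt0.
  have [N3 yN] := y0 _ e0.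
  exists (maxn N1 (maxn N2 N3)) => n; rewrite !geq_max.
  move=> /and3P[n1 n2 n3].
  rewrite [X in rat_pabs p X](_ : _ = a n * x n + y n)//.
  apply: rat_pabs_lt => //; last exact: yN.
  rewrite rat_pabsM//.
  rewrite -(divfK (lt0r_neq0 B0) e) mulrC ltr_pM ?rat_pabs_ge0//.
    exact: xN.
  exact: aB.
Qed.

HB.instance Definition _ :=
  isIdealr.Build cauchy_seq null_pred null_idealr_closed.

Lemma nonnull_bounded x : x \notin null_pred ->
  exists2 e : rat, 0 < e & exists N : nat, forall n, (N <= n)%N ->
    e <= rat_pabs p (x n).
Proof.
move=> /asboolPn/existsNP[e /not_implyP[e0 /forallNP xe]].
have [N xN] := elimT (cauchyP _) (valP x) e e0.
exists e => //; exists N => n Nn; rewrite leNgt; apply/negP => xn.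
apply: (xe N) => m Nm; rewrite -(subrK (x n) (x m)).
by apply: rat_pabs_lt => //; exact: xN.
Qed.

Lemma nonnull_stationary x : x \notin null_pred ->
  exists N : nat, forall n, (N <= n)%N -> rat_pabs p (x n) = rat_pabs p (x N).
Proof.
move=> /nonnull_bounded[e e0 [N1 xe]].
have [N2 xN] := elimT (cauchyP _) (valP x) e e0.
have le_abs m n : (maxn N1 N2 <= m)%N -> (maxn N1 N2 <= n)%N ->
    rat_pabs p (x m) <= rat_pabs p (x n).
  rewrite !geq_max => /andP[m1 m2] /andP[n1 n2].
  rewrite -(subrK (x n) (x m)) (le_trans (rat_pabs_max p_pr _ _))//.
  by rewrite ge_max lexx andbT (le_trans (ltW (xN _ _ m2 n2)))// xe.
by exists (maxn N1 N2) => n nN; apply/eqP; rewrite eq_le !le_abs.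
Qed.

Lemma cauchy_inv x : x \notin null_pred ->
  (fun n => (x n)^-1) \in cauchy.
Proof.
move=> /nonnull_bounded[d d0 [N1 xd]]; apply/cauchyP => e e0.
have [|N2 xN] := elimT (cauchyP _) (valP x) (e * (d * d)).
  by rewrite !mulr_gt0.
exists (maxn N1 N2) => m n; rewrite !geq_max => /andP[m1 m2] /andP[n1 n2].
have nz k : (N1 <= k)%N -> x k != 0.
  by move=> /xd; apply: contraTneq => ->; rewrite rat_pabs0 -ltNge.
have -> : (x m)^-1 - (x n)^-1 = (x n - x m) / (x m * x n).
  rewrite mulrBl invfM mulrCA mulfV ?nz// mulr1.
  by rewrite mulrA mulfV ?nz// mul1r.
rewrite rat_pabsM// rat_pabsV// ltr_pdivrMr; last first.
  by rewrite rat_pabs_gt0// mulf_neq0 ?nz.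
rewrite (lt_le_trans (xN _ _ n2 m2))// ler_pM2l// rat_pabsM//.
by rewrite ler_pM ?xd// ltW.
Qed.

Definition padic := {ideal_quot null_pred}.

HB.instance Definition _ := GRing.ComNzRing.on padic.
HB.instance Definition _ := EqQuotient.on padic.
Local Notation pi := (\pi_padic%qT).

Lemma pi_eq0 x : (pi x == 0) = (x \in null_pred).
Proof. by rewrite -(subr0 x) Quotient.idealrBE -(rmorph0 pi) subr0. Qed.

Definition padic_inv (x : padic) : padic := xget 0 [set y | y * x = 1].

Lemma padic_mulVx (x : padic) : x != 0 -> padic_inv x * x = 1.
Proof.
rewrite -[x]reprK pi_eq0 => x0; set u := repr x in x0 *.
have [d d0 [N xd]] := nonnull_bounded x0.
suff : pi (CauchySeq (cauchy_inv x0)) * pi u = 1.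
  by move=> xy; rewrite /padic_inv; case: xgetP => [y _ //|/(_ _ xy)].
rewrite -rmorphM -(rmorph1 pi); apply/eqP; rewrite -subr_eq0 -rmorphB pi_eq0.
apply/nullP => e e0; exists N => n Nn.
rewrite [X in rat_pabs p X](_ : _ = (u n)^-1 * u n - 1)//.
rewrite mulVf ?subrr ?rat_pabs0//.
by move: (xd _ Nn); apply: contraTneq => ->; rewrite rat_pabs0 -ltNge.
Qed.

Lemma padic_inv0 : padic_inv 0 = 0.
Proof.
rewrite /padic_inv; case: xgetP => // y _ /= /eqP.
by rewrite mulr0 eq_sym oner_eq0.
Qed.

HB.instance Definition _ :=
  GRing.ComNzRing_isField.Build padic padic_mulVx padic_inv0.

(* The limit exists already in rat, see padic_abs_pi: |.|_p takes its values
   in the set of 0 and the powers of p. *)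
Definition padic_abs (x : padic) : rat :=
  lim ((rat_pabs p (repr x n) : rat^o) @[n --> \oo]).

Lemma padic_abs_pi (u : cauchy_seq) :
  (rat_pabs p (u n) : rat^o) @[n --> \oo] --> (padic_abs (pi u) : rat^o).
Proof.
have cvg_abs (v : cauchy_seq) : cvg ((rat_pabs p (v n) : rat^o) @[n --> \oo]).
  have [/nullP v0|/nonnull_stationary[N vN]] := boolP (v \in null_pred).
    apply/cvg_ex; exists 0; apply/cvgrPdist_lt => e e0.
    have [N vN] := v0 _ e0; exists N => // n /= Nn.
    by rewrite sub0r normrN ger0_norm ?rat_pabs_ge0 ?vN.
  apply/cvg_ex; exists (rat_pabs p (v N)); apply/cvgrPdist_lt => e e0.
  by exists N => // n /= Nn; rewrite vN// subrr normr0.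
rewrite /padic_abs; set v := repr _.
have : (rat_pabs p (v n) : rat^o) @[n --> \oo] -->
  lim ((rat_pabs p (v n) : rat^o) @[n --> \oo]) by exact: cvg_abs.
set l := lim _ => vl; apply/cvgrPdist_lt => e e0.
have uv : u - v \in null_pred.
  by rewrite -pi_eq0 rmorphB subr_eq0 -[X in X == _]reprK.
have e20 : 0 < e / 2 by rewrite divr_gt0.
move: vl => /cvgrPdist_lt/(_ _ e20)[M _ vM].
have [N uN] := elimT (nullP _) uv _ e20.
exists (maxn M N) => // n /=; rewrite geq_max => /andP[Mn Nn].
rewrite (splitr e) -(subrK (rat_pabs p (v n)) l) -addrA.
rewrite (le_lt_trans (ler_normD _ _))// ltrD ?vM//.
rewrite distrC (le_lt_trans (rat_pabs_dist p_pr _ _))//.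
exact: uN.
Qed.
Arguments padic_abs_pi u : clear implicits.

Let uniq_lim (u : nat -> rat) (a b : rat) :
  (u n : rat^o) @[n --> \oo] --> (a : rat^o) ->
  (u n : rat^o) @[n --> \oo] --> (b : rat^o) -> a = b.
Proof. exact: cvg_unique. Qed.

Lemma padic_abs0 : padic_abs 0 = 0.
Proof.
suff <- : padic_abs (pi 0) = 0 by rewrite rmorph0.
apply: uniq_lim (padic_abs_pi 0) _.
rewrite [X in X @ _](_ : _ = cst 0); first exact: cvg_cst.
by apply/funext => n; exact: rat_pabs0.
Qed.

Lemma padic_absB (x y : padic) : padic_abs (x - y) = padic_abs (y - x).
Proof.
rewrite -[x]reprK -[y]reprK -!rmorphB; apply: uniq_lim (padic_abs_pi _) _.
rewrite [X in X @ _](_ : _ = fun n => rat_pabs p ((repr y - repr x) n)).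
  exact: padic_abs_pi.
apply/funext => n; rewrite [LHS](_ : _ = rat_pabs p (repr x n - repr y n))//.
by rewrite rat_pabsB.
Qed.

Lemma padic_abs_eq0 (x : padic) : padic_abs x = 0 -> x = 0.
Proof.
rewrite -[x]reprK => x0; apply/eqP; rewrite pi_eq0; apply/negPn/negP.
move=> /nonnull_bounded[e e0 [N xe]].
have := padic_abs_pi (repr x); rewrite x0 => /cvgrPdist_lt/(_ _ e0)[M _ xM].
have := xM (maxn N M) (leq_maxr _ _).
rewrite /= sub0r normrN ger0_norm ?rat_pabs_ge0// ltNge.
by rewrite xe// leq_maxl.
Qed.

Lemma padic_absD (x y : padic) : padic_abs (x + y) <= padic_abs x + padic_abs y.
Proof.
rewrite -[x]reprK -[y]reprK -!rmorphD.
apply/ler_addgt0Pr => e e0; have e30 : 0 < e / 3 by rewrite divr_gt0.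
have /cvgrPdist_lt/(_ _ e30)[A _ /= hA] := padic_abs_pi (repr x + repr y).
have /cvgrPdist_lt/(_ _ e30)[B _ /= hB] := padic_abs_pi (repr x).
have /cvgrPdist_lt/(_ _ e30)[C _ /= hC] := padic_abs_pi (repr y).
pose n := maxn A (maxn B C).
have := hA n (leq_maxl _ _).
have := hB n (leq_trans (leq_maxl _ _) (leq_maxr _ _)).
have := hC n (leq_trans (leq_maxr _ _) (leq_maxr _ _)).
have := rat_pabsD p_pr (repr x n) (repr y n).
rewrite -[repr x n + repr y n]/((repr x + repr y) n) !ltr_norml.
move=> ? /andP[? _] /andP[? _] /andP[_ ?]; lra.
Qed.

Let padic_dist (x y : padic) := padic_abs (x - y).

Let padic_distxx (x : padic) : padic_dist x x = 0.
Proof. by rewrite /padic_dist subrr padic_abs0. Qed.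

Let padic_dist_eq0 (x y : padic) : padic_dist x y = 0 -> x = y.
Proof. by move=> /padic_abs_eq0/eqP; rewrite subr_eq0 => /eqP. Qed.

Let padic_dist_triangle (y x z : padic) :
  padic_dist x z <= padic_dist x y + padic_dist y z.
Proof. by rewrite /padic_dist -{1}(subrK y x) -addrA padic_absD. Qed.

HB.instance Definition _ := isMetric.Build rat padic
  padic_distxx padic_dist_eq0 padic_absB padic_dist_triangle.

End CauchySequences.

Definition prime3 : prime 3 := isT.

Notation Q3 := (padic prime3).

Definition E3 (R : realType) : set Q3 :=
  [set x | ratr (padic_abs (x - 1)) < 3 `^ (- 2^-1) :> R].

(* Dynamics of a partial self-map: [f x = None] where f is undefined. *)
Section PartialDynamics.
Variables (T : Type) (f : T -> option T).

Definition piter (n : nat) (x : T) : option T := iter n (obind f) (Some x).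

Definition piter_preimage (n : nat) (S : set T) : set T :=
  [set x | exists2 y, S y & piter n x = Some y].

End PartialDynamics.

Definition basin (T : topologicalType) (f : T -> option T) (x0 : T) : set T :=
  [set x | exists2 u : nat -> T,
    forall n, piter f n x = Some (u n) & u n @[n --> \oo] --> x0].

Section PottsBethe.
Variables (K : fieldType) (theta q : K).

Definition potts_pole : K := 2 - theta - q.

Definition potts_bethe (k : nat) (x : K) : option K :=
  if x == potts_pole then None
  else Some (((theta * x + q - 1) / (x + theta + q - 2)) ^+ k).

Definition potts_cubic (y : K) : K :=
  y ^+ 3 - (1 + theta + theta ^+ 2) * y ^+ 2
    - (2 * theta + 1) * (1 - theta - q) * y - (1 - theta - q) ^+ 2.

Definition potts_fixed1 (y : K) : K := 1 - q + (theta - 1) * (y - 1).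

End PottsBethe.

(* Main.v *)
(* Write [t = theta - 1] and [d = x - pole]. Then
   [f x = (1 + w) ^ 3] with [w = t (x - 1) / d]. Comparing absolute values, [f]
   contracts the ball [|x - 1| < |q|] to [1] and sends every [x] with
   [|x - 1| > |q|] into it. On the sphere [|x - 1| = |q|] one has either
   [|w| >= 1], and then [|f x - 1| >= 1], or [|w| <= 1/3], and then
   [|f x - 1| = |w| / 3]; hence the image lies on the sphere again only if
   [|w| = 3 |q|], that is [|d| = |t| / 3], which is impossible for [|q| = 1/3].
   For [|q| < 1/3] the map multiplies distances by [3 |q| / |t| >= 9] on
   [|d| = |t| / 3], so at most one point has its whole orbit there. A fixed
   point other than [1] is such a point; fixed points correspond to the roots of
   the cubic, and dividing the cubic by [y ^ 2] gives a root by the contraction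
   principle on the ball [|y - 3| <= 1/9]. *)
Require Import Defs.
From mathcomp Require Import all_boot all_order all_algebra.
From mathcomp Require Import all_classical all_reals all_analysis.
From mathcomp Require Import ring lra.

Set Implicit Arguments.
Unset Strict Implicit.
Unset Printing Implicit Defensive.

Import Order.TTheory GRing.Theory Num.Theory.
Import numFieldNormedType.Exports.

Local Open Scope classical_set_scope.
Local Open Scope ring_scope.

Lemma expr_lt_eps (R : archiRealFieldType) (c e : R) : 0 <= c -> c < 1 -> 0 < e ->
  exists N : nat, c ^+ N < e.
Proof.
move=> c0 c1 e0; have nc : `|c| < 1 by rewrite ger0_norm.
have := cvg_expr nc; move/cvgrPdist_lt => /(_ _ e0)[N _ hN]; exists N.
by have := hN N (leqnn N); rewrite /= sub0r normrN ger0_norm// exprn_ge0.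
Qed.

(** * The ultrametric absolute value on [padic] and its completeness *)

Section PadicAbs.
Variables (p : nat) (p_pr : prime p).
Implicit Types x y z : padic p_pr.
Local Notation pi := (\pi_(padic p_pr)%qT).

(** The limit defining [padic_abs] is attained, so identities between absolute values can be checked
    at one large index. *)
Lemma padic_abs_stationary (u : cauchy_seq p_pr) : pi u != 0 ->
  exists N : nat, forall n, (N <= n)%N -> rat_pabs p (u n) = padic_abs (pi u).
Proof.
rewrite pi_eq0 => /nonnull_stationary[N uN]; exists N => n Nn; rewrite uN//.
have uniq_lim (v : nat -> rat) (a b : rat) :
    (v n : rat^o) @[n --> \oo] --> (a : rat^o) ->
    (v n : rat^o) @[n --> \oo] --> (b : rat^o) -> a = b.
  exact: cvg_unique.
apply: uniq_lim (padic_abs_pi (u := u)); apply/cvgrPdist_lt => e e0.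
by exists N => // m /= Nm; rewrite (uN m Nm) subrr normr0.
Qed.

(** A limit of values below [e] is in general only at most [e]. Strictness survives because the
    values are eventually constant, or the class is zero. *)
Lemma padic_abs_piP (u : cauchy_seq p_pr) (e : rat) : 0 < e ->
  (exists N : nat, forall n, (N <= n)%N -> rat_pabs p (u n) < e) <->
  padic_abs (pi u) < e.
Proof.
move=> e0; split=> [[N uN]|].
  have [->|/padic_abs_stationary[M uM]] := eqVneq (pi u) 0.
    by rewrite padic_abs0.
  by rewrite -(uM (maxn N M)) ?leq_maxr// uN// leq_maxl.
have [/eqP|/padic_abs_stationary[M uM]] := eqVneq (pi u) 0.
  by rewrite pi_eq0 => /nullP/(_ _ e0).
by move=> ue; exists M => n /uM ->.
Qed.

Lemma padic_abs_eq_pi (u : cauchy_seq p_pr) : pi u != 0 ->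
  exists2 r : rat, r != 0 & padic_abs (pi u) = rat_pabs p r.
Proof.
move=> u0; have [N uN] := padic_abs_stationary u0.
exists (u N); last by rewrite uN.
rewrite -(rat_pabs_eq0 p_pr) uN//; apply: contraNneq u0 => /padic_abs_eq0 ->.
exact: eqxx.
Qed.

Lemma padic_abs_valued x : x != 0 ->
  exists k : int, padic_abs x = p%:R ^ k.
Proof.
rewrite -[x]reprK => /padic_abs_eq_pi[r r0 ->].
by rewrite /rat_pabs (negbTE r0); eexists.
Qed.

Lemma padic_abs_ge0 x : 0 <= padic_abs x.
Proof.
have [->|/padic_abs_valued[k ->]] := eqVneq x 0; first by rewrite padic_abs0.
by rewrite exprz_ge0.
Qed.

Lemma padic_abs_gt0 x : (0 < padic_abs x) = (x != 0).
Proof.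
rewrite lt_neqAle padic_abs_ge0 andbT eq_sym.
by congr negb; apply/eqP/eqP => [/padic_abs_eq0//|->]; rewrite padic_abs0.
Qed.

Lemma padic_abs_eq0E x : (padic_abs x == 0) = (x == 0).
Proof. by apply: negb_inj; rewrite -padic_abs_gt0 lt0r padic_abs_ge0 andbT. Qed.

(** Nonzero values are integral powers of [p], so a strict inequality is a gap of at least one
    exponent. *)
Lemma padic_abs_lt_mul x y : padic_abs x < padic_abs y ->
  p%:R * padic_abs x <= padic_abs y.
Proof.
have p0 : (p%:R : rat) != 0 by rewrite pnatr_eq0 -lt0n prime_gt0.
have p1 : 1 < p%:R :> rat by rewrite ltr1n prime_gt1.
have [->|x0] := eqVneq x 0; first by rewrite padic_abs0 mulr0 padic_abs_ge0.
move=> xy; have y0 : y != 0 by rewrite -padic_abs_gt0 (le_lt_trans _ xy)// padic_abs_ge0.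
move: xy; have [k ->] := padic_abs_valued x0.
have [l ->] := padic_abs_valued y0.
by rewrite ltr_eXz2l// -[X in X * _]expr1z -expfzDr// ler_eXz2l// lez1D.
Qed.

Lemma padic_absM x y : padic_abs (x * y) = padic_abs x * padic_abs y.
Proof.
have [->|x0] := eqVneq x 0; first by rewrite mul0r padic_abs0 mul0r.
have [->|y0] := eqVneq y 0; first by rewrite mulr0 padic_abs0 mulr0.
have xy0 : x * y != 0 by rewrite mulf_neq0.
move: x0 y0 xy0; rewrite -[x]reprK -[y]reprK -rmorphM => x0 y0 xy0.
have [A hA] := padic_abs_stationary x0.
have [B hB] := padic_abs_stationary y0.
have [C hC] := padic_abs_stationary xy0.
rewrite -(hA (maxn A (maxn B C))) ?leq_maxl//.
rewrite -(hB (maxn A (maxn B C))) ?(leq_trans (leq_maxl _ _) (leq_maxr _ _))//.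
rewrite -(hC (maxn A (maxn B C))) ?(leq_trans (leq_maxr _ _) (leq_maxr _ _))//.
exact: rat_pabsM.
Qed.

Lemma padic_abs_ltD x y (e : rat) : padic_abs x < e -> padic_abs y < e ->
  padic_abs (x + y) < e.
Proof.
rewrite -[x]reprK -[y]reprK -rmorphD => xe ye.
have e0 : 0 < e by rewrite (le_lt_trans _ xe)// padic_abs_ge0.
move: xe ye => /padic_abs_piP-/(_ e0)[M xM] /padic_abs_piP-/(_ e0)[N yN].
apply/padic_abs_piP => //; exists (maxn M N) => n; rewrite geq_max.
move=> /andP[/xM ? /yN ?]; exact: rat_pabs_lt.
Qed.

(** If the sum exceeded [e], the strict version with bound [padic_abs (x + y)] would be
    contradictory. *)
Lemma padic_abs_leD x y (e : rat) : padic_abs x <= e -> padic_abs y <= e ->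
  padic_abs (x + y) <= e.
Proof.
move=> xe ye; rewrite leNgt; apply/negP => exy.
by have := padic_abs_ltD (le_lt_trans xe exy) (le_lt_trans ye exy); rewrite ltxx.
Qed.

Lemma padic_abs_rat_approx (u : cauchy_seq p_pr) (e : rat) : 0 < e ->
  exists r : rat, exists N : nat, forall n, (N <= n)%N -> rat_pabs p (u n - r) < e.
Proof.
move=> e0; have [N uN] := elimT (Defs.cauchyP p_pr _) (valP u) e e0.
by exists (u N), N => n Nn; apply: uN.
Qed.

(** Diagonal argument: a rational [r n] is chosen within [1 / (n + 1)] of [y n]; the sequence [r] is
    Cauchy and its class is the limit. *)
Lemma padic_complete (y : nat -> padic p_pr) :
  (forall e : rat, 0 < e -> exists N : nat, forall m n : nat,
    (N <= m)%N -> (N <= n)%N -> padic_abs (y m - y n) < e) ->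
  exists x, y n @[n --> \oo] --> x.
Proof.
move=> yC; pose e n : rat := n.+1%:R^-1.
have e_gt0 n : 0 < e n by rewrite invr_gt0 ltr0n.
have e_lt (d : rat) : 0 < d -> exists N : nat, forall n, (N <= n)%N -> e n < d.
  move=> d0; have := @cvg_harmonic rat; move/cvgrPdist_lt => /(_ _ d0)[N _ hN].
  by exists N => n /hN /=; rewrite sub0r normrN ger0_norm// invr_ge0 ler0n.
have [r rP] := choice (fun n => padic_abs_rat_approx (repr (y n)) (e_gt0 n)).
have rC : r \in cauchy_pred p_pr.
  apply/Defs.cauchyP => d d0; have [N1 yN] := yC d d0; have [N2 eN] := e_lt d d0.
  exists (maxn N1 N2) => m n; rewrite !geq_max => /andP[m1 m2] /andP[n1 n2].
  have := yN m n m1 n1; rewrite -[y m]reprK -[y n]reprK -rmorphB.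
  move=> /padic_abs_piP-/(_ d0)[A hA].
  have [B hB] := rP m; have [C hC] := rP n.
  pose j := maxn A (maxn B C).
  (* Passing through the representatives at a common late index [j] makes all three summands
     small. *)
  have -> : r m - r n = - (repr (y m) j - r m)
      + ((repr (y m) j - repr (y n) j) + (repr (y n) j - r n)).
    by ring.
  apply: rat_pabs_lt => //.
    rewrite rat_pabsN// (lt_trans _ (eN m m2))// hB//.
    exact: leq_trans (leq_maxl _ _) (leq_maxr _ _).
  apply: rat_pabs_lt => //; first by apply: hA; rewrite leq_maxl.
  rewrite (lt_trans _ (eN n n2))// hC//.
  exact: leq_trans (leq_maxr _ _) (leq_maxr _ _).
exists (pi (CauchySeq rC)); apply/cvg_ballP => d d0.
have [N1 eN] := e_lt d d0; have [N2 rN] := elimT (Defs.cauchyP p_pr _) rC d d0.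
exists (maxn N1 N2) => // n /=; rewrite geq_max => /andP[n1 n2].
rewrite ballEmdist /= -[mdist _ _]/(padic_abs (_ - y n)) padic_absB.
rewrite -[y n]reprK -rmorphB; apply/padic_abs_piP => //.
have [B hB] := rP n; exists (maxn N2 B) => j; rewrite geq_max => /andP[j2 jB].
rewrite [X in rat_pabs p X](_ : _ = (repr (y n) j - r n) + (r n - r j)).
  apply: rat_pabs_lt => //; last exact: rN.
  exact: lt_trans (hB j jB) (eN n n1).
by rewrite [LHS](_ : _ = repr (y n) j - r j)//; ring.
Qed.

Lemma padic_cvgP (y : nat -> padic p_pr) x : y n @[n --> \oo] --> x <->
  (forall e : rat, 0 < e -> exists N : nat, forall n, (N <= n)%N ->
    padic_abs (y n - x) < e).
Proof.
split=> [/cvg_ballP yx e /yx[N _ hN]|yx].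
  exists N => n /hN; rewrite /= ballEmdist /= -[mdist _ _]/(padic_abs (x - _)).
  by rewrite padic_absB.
apply/cvg_ballP => e /yx[N hN]; exists N => // n /= /hN.
by rewrite ballEmdist /= -[mdist _ _]/(padic_abs (x - _)) padic_absB.
Qed.

(** Iteration of [phi] from the centre [a]. By the ultrametric inequality the bound on one step also
    bounds every later displacement, without summing a geometric series. *)
Lemma padic_contraction_fixpoint (phi : padic p_pr -> padic p_pr) a (rho c : rat) :
  0 <= c -> c < 1 -> 0 < rho ->
  (forall y, padic_abs (y - a) <= rho -> padic_abs (phi y - a) <= rho) ->
  (forall y z, padic_abs (y - a) <= rho -> padic_abs (z - a) <= rho ->
    padic_abs (phi y - phi z) <= c * padic_abs (y - z)) ->
  exists2 y, padic_abs (y - a) <= rho & phi y = y.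
Proof.
move=> c0 c1 rho0 phiB phiC.
pose y n := iter n phi a.
have yB n : padic_abs (y n - a) <= rho.
  by elim: n => [|n]; [rewrite /y/= subrr padic_abs0 ltW|exact: phiB].
have yS k : padic_abs (y k.+1 - y k) <= c ^+ k * rho.
  elim: k => [|k IHk]; first by rewrite expr0 mul1r (yB 1).
  rewrite exprS -mulrA (le_trans (phiC _ _ (yB k.+1) (yB k)))//.
  exact: ler_wpM2l.
have yD n k : padic_abs (y (n + k)%N - y n) <= c ^+ n * rho.
  elim: k => [|k IHk].
    by rewrite addn0 subrr padic_abs0 mulr_ge0 ?exprn_ge0// ltW.
  rewrite addnS -(subrK (y (n + k)%N) (y (n + k).+1)) -addrA padic_abs_leD//.
  rewrite (le_trans (yS _))// ler_wpM2r ?(ltW rho0)// exprD ler_piMr ?exprn_ge0//.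
  by rewrite exprn_ile1// ltW.
have c_lt (e : rat) : 0 < e -> exists N : nat, c ^+ N * rho < e.
  move=> e0; have [N hN] := expr_lt_eps c0 c1 (divr_gt0 e0 rho0).
  by exists N; rewrite -ltr_pdivlMr.
have yN e : 0 < e -> exists N : nat, forall n, (N <= n)%N ->
    padic_abs (y n - y N) < e.
  move=> /c_lt[N hN]; exists N => n Nn; apply: le_lt_trans hN.
  by rewrite -(subnKC Nn).
have [|x /padic_cvgP yx] := @padic_complete y.
  move=> e /yN[N hN]; exists N => m n Nm Nn.
  rewrite -(subrK (y N) (y m)) -addrA padic_abs_ltD ?hN//.
  by rewrite padic_absB hN.
have xB : padic_abs (x - a) <= rho.
  have [N hN] := yx _ rho0; rewrite -(subrK (y N) x) -addrA padic_abs_leD//.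
  by rewrite padic_absB ltW// hN.
(* The distance from [phi x] to [x] is at most every [e > 0]: both are compared with
   [y N.+1 = phi (y N)], where [y N] is within [e] of [x]. *)
exists x => //; apply/eqP; rewrite -subr_eq0 -padic_abs_eq0E eq_le padic_abs_ge0.
rewrite andbT; apply/ler_addgt0Pr => e e0; rewrite add0r; have [N hN] := yx _ e0.
have e1 : padic_abs (y N - x) <= e by rewrite ltW// hN.
rewrite -(subrK (y N.+1) (phi x)) -addrA padic_abs_leD//; last first.
  by rewrite ltW// hN.
rewrite padic_absB (le_trans (phiC _ _ (yB N) xB))// (le_trans _ e1)//.
by rewrite ler_piMl ?padic_abs_ge0// ltW.
Qed.

End PadicAbs.

Lemma rat_pabs_prime p : prime p -> rat_pabs p p%:R = p%:R^-1.
Proof.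
move=> p_pr; have p0 : (p%:R : rat) != 0 by rewrite pnatr_eq0 -lt0n prime_gt0.
have -> : rat_pabs p p%:R = p%:R ^ (- rat_vp p p%:R) by rewrite /rat_pabs (negbTE p0).
have -> : (p%:R : rat) = (Posz p)%:~R / 1%:~R by rewrite divr1.
rewrite rat_vpE//; last by rewrite -lt0n prime_gt0.
by rewrite logn_prime// eqxx logn1 subr0 divr1.
Qed.

Lemma padic_abs_prime p (p_pr : prime p) :
  padic_abs (p%:R : padic p_pr) = p%:R^-1.
Proof.
have valE m n : (m%:R : cauchy_seq p_pr) n = m%:R.
  by elim: m => // m IHm; rewrite !mulrS -IHm.
have -> : p%:R = \pi_(padic p_pr)%qT (p%:R : cauchy_seq p_pr) by rewrite rmorph_nat.
have n0 : \pi_(padic p_pr)%qT (p%:R : cauchy_seq p_pr) != 0.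
  (* The constant sequence [p] has absolute value exactly [p^-1], so nullity fails for this very
     bound. *)
  rewrite pi_eq0; apply/negP => /nullP/(_ p%:R^-1).
  rewrite invr_gt0 ltr0n prime_gt0// => /(_ isT)[N /(_ N (leqnn N))].
  by rewrite valE rat_pabs_prime// ltxx.
have [N /(_ N (leqnn N)) <-] := padic_abs_stationary n0.
by rewrite valE rat_pabs_prime.
Qed.

(** * Infinite orbits of a partial map *)

Section Orbits.
Variables (T : Type) (f : T -> option T).

Lemma piterS n x y : piter f n x = Some y -> piter f n.+1 x = f y.
Proof. by rewrite /piter iterS => ->. Qed.

Definition is_orbit (x : T) (u : nat -> T) :=
  u 0%N = x /\ forall n, f (u n) = Some (u n.+1).

Lemma is_orbitP x u : is_orbit x u <-> forall n, piter f n x = Some (u n).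
Proof.
split=> [[<- uS]|xu]; first by elim=> // n /piterS ->.
by split=> [|n]; [have [] := xu 0%N|rewrite -(piterS (xu n)) xu].
Qed.

(** An iteration can stop only where [f] is undefined, that is at [a]. *)
Lemma orbit_total (a x : T) : (forall y, f y = None -> y = a) ->
  ~ (\bigcup_n piter_preimage f n [set a]) x -> exists u, is_orbit x u.
Proof.
move=> fN xa.
suff /choice[u xu] : forall n, exists y, piter f n x = Some y.
  by exists u; apply/is_orbitP.
elim=> [|n [y xy]]; first by exists x.
case fy : (f y) => [z|]; first by exists z; rewrite (piterS xy).
by case: xa; exists n => //; exists y => //; exact: fN.
Qed.

Lemma orbit_not_preimage (a x : T) u : f a = None -> is_orbit x u ->
  ~ (\bigcup_n piter_preimage f n [set a]) x.
Proof.
by move=> fa /is_orbitP xu [n _ [y /= -> /piterS]]; rewrite xu fa.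
Qed.

Lemma orbit_fixed x u : f x = Some x -> is_orbit x u -> forall n, u n = x.
Proof. by move=> fx [u0 uS]; elim=> // n un; move: (uS n); rewrite un fx => -[]. Qed.

End Orbits.

(** * Algebraic identities for the mapping and its fixed points *)

Section PottsBetheAlgebra.
Variables (K : fieldType) (theta q : K).

Definition potts_deviation (x : K) : K :=
  (theta - 1) * (x - 1) / (x - potts_pole theta q).

Lemma potts_betheE k x : x != potts_pole theta q ->
  potts_bethe theta q k x = Some ((1 + potts_deviation x) ^+ k).
Proof.
move=> xp; rewrite /potts_bethe (negbTE xp); congr (Some (_ ^+ k)).
have d0 : x - potts_pole theta q != 0 by rewrite subr_eq0.
have -> : x + theta + q - 2 = x - potts_pole theta q by rewrite /potts_pole; ring.
rewrite -[1 in RHS](divff d0) /potts_deviation -mulrDl; congr (_ / _).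
by rewrite /potts_pole; ring.
Qed.

(** The deviation is a Moebius function of [x]; the constant on the right is its determinant. *)
Lemma potts_deviationB x x' :
  x != potts_pole theta q -> x' != potts_pole theta q ->
  (potts_deviation x - potts_deviation x') *
    ((x - potts_pole theta q) * (x' - potts_pole theta q)) =
  (theta - 1) * (theta - 1 + q) * (x - x').
Proof.
rewrite -subr_eq0 -(subr_eq0 x') /potts_deviation => d0 d0'.
have -> : theta - 1 + q = 1 - potts_pole theta q by rewrite /potts_pole; ring.
by field; rewrite d0 d0'.
Qed.

Lemma potts_bethe_None k x :
  potts_bethe theta q k x = None -> x = potts_pole theta q.
Proof. by rewrite /potts_bethe; case: eqP. Qed.

Lemma potts_bethe_pole k :
  potts_bethe theta q k (potts_pole theta q) = None.
Proof. by rewrite /potts_bethe eqxx. Qed.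

Lemma potts_fixed1_sub_pole y :
  potts_fixed1 theta q y - potts_pole theta q = (theta - 1) * y.
Proof. by rewrite /potts_fixed1 /potts_pole; ring. Qed.

(* The excluded value [(theta - 1) * y = theta + q - 1] is the one for which
   [potts_fixed1 theta q y] is the trivial fixed point [1]. *)
Lemma potts_fixed1P y : theta != 1 -> y != 0 ->
  (theta - 1) * y != theta + q - 1 ->
  potts_bethe theta q 3 (potts_fixed1 theta q y) = Some (potts_fixed1 theta q y)
  <-> potts_cubic theta q y = 0.
Proof.
move=> t1 y0 ys; have t0 : theta - 1 != 0 by rewrite subr_eq0.
have xp : potts_fixed1 theta q y != potts_pole theta q.
  by rewrite -subr_eq0 potts_fixed1_sub_pole mulf_neq0.
set x := potts_fixed1 theta q y in xp *.
have -> : potts_bethe theta q 3 x = Some x <-> (1 + potts_deviation x) ^+ 3 = x.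
  by rewrite potts_betheE//; split=> [[]//|->].
have wE : 1 + potts_deviation x = theta - (theta + q - 1) / y.
  rewrite /potts_deviation potts_fixed1_sub_pole /x /potts_fixed1.
  by field; rewrite y0 t0.
(* Clearing denominators in the fixed point equation gives a quartic in [y]; the trivial fixed point
   splits off as a linear factor and leaves the cubic. *)
have fE : y ^+ 3 * ((1 + potts_deviation x) ^+ 3 - x) =
    - ((theta - 1) * y - (theta + q - 1)) * potts_cubic theta q y.
  rewrite wE /x /potts_fixed1 /potts_cubic.
  by field.
split=> [fx|c0].
  move: fE; rewrite fx subrr mulr0 => /esym/eqP.
  by rewrite mulf_eq0 oppr_eq0 subr_eq0 (negbTE ys) => /eqP.
move: fE; rewrite c0 mulr0 => /eqP.
by rewrite mulf_eq0 expf_eq0/= (negbTE y0) subr_eq0 => /eqP.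
Qed.

End PottsBetheAlgebra.

(* The last two axioms make [v] discrete, with value group generated by [v p]. *)
Record unramified_abs (p : nat) (K : fieldType) (R : archiRealFieldType)
    (v : K -> R) : Prop := {
  uabs_ge0 : forall x, 0 <= v x;
  uabs_eq0 : forall x, (v x == 0) = (x == 0);
  uabsM : forall x y, v (x * y) = v x * v y;
  uabs_leD : forall x y e, v x <= e -> v y <= e -> v (x + y) <= e;
  uabs_lt_mul : forall x y, v x < v y -> p%:R * v x <= v y;
  uabs_uniformizer : v p%:R = p%:R^-1 }.

(** * Consequences of the ultrametric axioms *)

Section UnramifiedAbs.
Variables (p : nat) (K : fieldType) (R : archiRealFieldType) (v : K -> R).
Hypothesis vP : unramified_abs p v.

Lemma uabs0 : v 0 = 0.
Proof. by apply/eqP; rewrite (uabs_eq0 vP). Qed.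

Lemma uabs_gt0 x : (0 < v x) = (x != 0).
Proof. by rewrite lt0r (uabs_ge0 vP) andbT (uabs_eq0 vP). Qed.

Lemma uabs1 : v 1 = 1.
Proof.
have n0 : v 1 != 0 by rewrite (uabs_eq0 vP) oner_eq0.
by apply: (mulfI n0); rewrite -(uabsM vP) !mulr1.
Qed.

Lemma uabsN x : v (- x) = v x.
Proof.
have vN1 : v (- 1) = 1.
  apply/eqP; rewrite -(eqrXn2 (n := 2)) ?(uabs_ge0 vP)// expr1n expr2.
  by rewrite -(uabsM vP) mulrNN mulr1 uabs1.
by rewrite -mulN1r (uabsM vP) vN1 mul1r.
Qed.

Lemma uabsV x : v x^-1 = (v x)^-1.
Proof.
have [->|x0] := eqVneq x 0; first by rewrite !(uabs0, invr0).
have n0 : v x != 0 by rewrite (uabs_eq0 vP).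
by apply: (mulfI n0); rewrite -(uabsM vP) !divff// uabs1.
Qed.

Lemma uabs_leB x y e : v x <= e -> v y <= e -> v (x - y) <= e.
Proof. by move=> xe ye; rewrite (uabs_leD vP)// uabsN. Qed.

(** Since [x = (x + y) - y], the sum cannot be smaller than [x] when [y] is. *)
Lemma uabsDl x y : v y < v x -> v (x + y) = v x.
Proof.
move=> yx; apply/eqP; rewrite eq_le (uabs_leD vP) ?lexx ?(ltW yx)//=.
rewrite leNgt; apply/negP => xyx.
have : v (x + y - y) <= Num.max (v (x + y)) (v y).
  by rewrite uabs_leB// le_max lexx ?orbT.
by rewrite addrK leNgt gt_max xyx yx.
Qed.

Lemma uabsDr x y : v x < v y -> v (x + y) = v y.
Proof. by move=> xy; rewrite addrC uabsDl. Qed.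

End UnramifiedAbs.

(** * Cubes near and far from 1 when 3 is a uniformizer *)

Section Abs3.
Variables (K : fieldType) (R : archiRealFieldType) (v : K -> R).
Hypothesis vP : unramified_abs 3 v.

Lemma uabs3_lt1 x : v x < 1 -> v x <= 3^-1.
Proof. by rewrite -[1](uabs1 vP) => /(uabs_lt_mul vP); rewrite (uabs1 vP); lra. Qed.

Lemma uabs3_lt3V x : v x < 3^-1 -> v x <= 9^-1.
Proof.
by rewrite -(uabs_uniformizer vP) => /(uabs_lt_mul vP); rewrite (uabs_uniformizer vP); lra.
Qed.

(** The cofactor of [a - b] is 3 plus terms of absolute value at most [9^-1], so the summand 3
    dominates. *)
Lemma uabs3_cubeB a b : v a <= 3^-1 -> v b <= 3^-1 ->
  v ((1 + a) ^+ 3 - (1 + b) ^+ 3) = v (a - b) / 3.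
Proof.
move=> a1 b1; have v3 := uabs_uniformizer vP.
have vM x y : v x <= 3^-1 -> v y <= 3^-1 -> v (x * y) <= 9^-1.
  move=> x1 y1; rewrite (uabsM vP) (_ : 9^-1 = 3^-1 * 3^-1); last lra.
  by rewrite ler_pM ?(uabs_ge0 vP).
have -> : (1 + a) ^+ 3 - (1 + b) ^+ 3 =
    (a - b) * (3 + (3 * (a + b) + (a * a + (a * b + b * b)))) by ring.
rewrite (uabsM vP) (@uabsDl _ _ _ _ vP 3) v3//.
apply: (@le_lt_trans _ _ 9^-1); last lra.
by rewrite !(uabs_leD vP)// ?vM ?v3// (uabs_leD vP).
Qed.

Lemma uabs3_cube_small a : v a <= 3^-1 -> v ((1 + a) ^+ 3 - 1) = v a / 3.
Proof.
move=> a1; have := @uabs3_cubeB a 0 a1.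
by rewrite (uabs0 vP) addr0 subr0 expr1n; apply.
Qed.

(** In the cofactor [a * a + 3 * (a + 1)] the square dominates, as the other term has absolute value
    at most [v a / 3]. *)
Lemma uabs3_cube_big a : 1 <= v a -> v ((1 + a) ^+ 3 - 1) = v a ^+ 3.
Proof.
move=> a1; have -> : (1 + a) ^+ 3 - 1 = a * (a * a + 3 * (a + 1)) by ring.
have a2 : v (3 * (a + 1)) < v (a * a).
  rewrite !(uabsM vP) (uabs_uniformizer vP).
  have : v (a + 1) <= v a by rewrite (uabs_leD vP) ?(uabs1 vP).
  have : v a <= v a * v a by rewrite ler_peMl// (uabs_ge0 vP).
  lra.
by rewrite (uabsM vP) (uabsDl vP a2) (uabsM vP) !exprS expr0 mulr1.
Qed.

End Abs3.

(** * Dynamics relative to the sphere of radius [v q] around 1 *)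

Section PottsBetheDynamics.
Variables (K : fieldType) (R : archiRealFieldType) (v : K -> R).
Hypothesis vP : unramified_abs 3 v.
Variables (theta q : K).
Local Notation t := (theta - 1).
Local Notation s := (theta - 1 + q).
Local Notation pole := (potts_pole theta q).
Local Notation w := (potts_deviation theta q).
Local Notation f := (potts_bethe theta q 3).
Hypothesis t_gt0 : 0 < v t.
Hypothesis t_lt_q : v t < v q.
Hypothesis q_lt1 : v q < 1.

Let s_abs : v s = v q. Proof. exact: (uabsDr vP). Qed.
Let q_gt0 : 0 < v q. Proof. exact: lt_trans t_lt_q. Qed.
Let q_le : v q <= 3^-1. Proof. exact: (uabs3_lt1 vP). Qed.
Let t_le : v t <= v q / 3.
Proof. by have := uabs_lt_mul vP t_lt_q; lra. Qed.

Let sub_pole x : x - pole = (x - 1) + s.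
Proof. by rewrite /potts_pole; ring. Qed.

Let w_abs x : x != pole -> v (w x) * v (x - pole) = v t * v (x - 1).
Proof.
by move=> xp; rewrite -!(uabsM vP) /potts_deviation divfK// subr_eq0.
Qed.

Local Ltac pottslra := move: t_gt0 t_lt_q q_gt0 q_lt1 q_le t_le; lra.

(** Here [x - pole] has absolute value [v q], so [v (w x) = v t * v (x - 1) / v q], at most
    [v (x - 1) / 3]. *)
Lemma potts_step_near x y : v (x - 1) < v q -> f x = Some y ->
  v (y - 1) <= v (x - 1) / 3.
Proof.
move=> xq; have [->|xp] := eqVneq x pole; first by rewrite potts_bethe_pole.
rewrite potts_betheE// => -[<-].
have := w_abs xp; rewrite sub_pole (@uabsDr _ _ _ _ vP (x - 1)) s_abs// => wE.
have u0 := uabs_ge0 vP (x - 1); have w0 := uabs_ge0 vP (w x).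
have wu : v (w x) <= v (x - 1) / 3.
  by rewrite -(ler_pM2r q_gt0) wE; have := ler_wpM2r u0 t_le; lra.
by rewrite (uabs3_cube_small vP); pottslra.
Qed.

(** Here [x - pole] and [x - 1] have the same absolute value, so [v (w x) = v t]. *)
Lemma potts_step_far x y : v q < v (x - 1) -> f x = Some y -> v (y - 1) < v q.
Proof.
move=> xq; have [->|xp] := eqVneq x pole; first by rewrite potts_bethe_pole.
rewrite potts_betheE// => -[<-].
have := w_abs xp; rewrite sub_pole (@uabsDl _ _ _ _ vP (x - 1)) ?s_abs//.
have u0 : v (x - 1) != 0 by rewrite gt_eqF// (lt_trans q_gt0).
by move=> /(mulIf u0) wE; rewrite (uabs3_cube_small vP) wE; pottslra.
Qed.

Lemma potts_step_sphere x y : f x = Some y ->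
  v (x - 1) = v q -> v (y - 1) = v q -> v q < 3^-1 /\ v (x - pole) = v t / 3.
Proof.
have [->|xp] := eqVneq x pole; first by rewrite potts_bethe_pole.
rewrite potts_betheE// => -[<-] xq; have := w_abs xp; rewrite xq.
have [w1|w1] := leP 1 (v (w x)).
  move=> _; rewrite (uabs3_cube_big vP)// => wq.
  by have := exprn_ege1 3 w1; pottslra.
have {}w1 := uabs3_lt1 vP w1; rewrite (uabs3_cube_small vP)// => wd wq.
(* Now [v (w x) / 3 = v q] with [v (w x) <= 3^-1] gives [v q <= 9^-1]. *)
split; first pottslra.
have {}wq : v (w x) = 3 * v q by lra.
by apply: (mulIf (lt0r_neq0 q_gt0)); move: wd; rewrite wq; lra.
Qed.

Lemma potts_orbit_near (u : nat -> K) k :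
  (forall n, f (u n) = Some (u n.+1)) -> v (u k - 1) != v q ->
  exists j, forall n, v (u (j + n)%N - 1) <= 3^-1 ^+ n.
Proof.
(* A point beyond the sphere enters the ball after one step, so [k] or [k.+1] can serve as starting
   index. *)
move=> uS; wlog uk : k / v (u k - 1) < v q.
  move=> near; rewrite neq_lt => /orP[uk|uk].
    by apply: (near k) => //; rewrite lt_eqF.
  have uk1 := potts_step_far uk (uS k).
  by apply: (near k.+1) => //; rewrite lt_eqF.
move=> _; exists k => n.
(* Membership in the ball is carried through the induction because [potts_step_near] needs it. *)
suff [] : v (u (k + n)%N - 1) < v q /\ v (u (k + n)%N - 1) <= 3^-1 ^+ n by [].
elim: n => [|n [IH1 IH2]].
  by rewrite addn0 expr0; split => //; pottslra.
have := potts_step_near IH1 (uS _); rewrite -addnS exprS.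
have := uabs_ge0 vP (u (k + n)%N - 1).
by move=> a0 ab; split; pottslra.
Qed.

(** Off the sphere, the constant orbit at [x] would approach 1, forcing [x = 1]. *)
Lemma potts_fixed_sphere x : f x = Some x -> x != 1 ->
  v q < 3^-1 /\ v (x - pole) = v t / 3.
Proof.
move=> fx x1; have [xq|] := eqVneq (v (x - 1)) (v q).
  exact: (potts_step_sphere fx xq xq).
have c0 : 0 <= 3^-1 :> R by lra.
have c1 : 3^-1 < 1 :> R by lra.
rewrite -subr_eq0 -(uabs_gt0 vP) in x1.
move=> /(@potts_orbit_near (fun=> x) 0 (fun=> fx))[_ xn].
have [N] := expr_lt_eps c0 c1 x1.
by rewrite ltNge xn.
Qed.

Lemma cubic_root_fixed1 y : potts_cubic theta q y = 0 ->
  potts_fixed1 theta q y != 1 /\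
  f (potts_fixed1 theta q y) = Some (potts_fixed1 theta q y).
Proof.
move=> cy; have t0 : t != 0 by rewrite -(uabs_gt0 vP).
have s0 : s != 0 by rewrite -(uabs_gt0 vP) s_abs.
(* The constant term of the cubic is [- s ^+ 2], which is nonzero. *)
have y0 : y != 0.
  apply: contraNneq s0 => y0; move: cy; rewrite y0 /potts_cubic.
  rewrite !expr0n/= !mulr0 !subr0 sub0r => /eqP; rewrite oppr_eq0 expf_eq0/=.
  by rewrite -opprB oppr_eq0 => /eqP e; apply/eqP; rewrite -e; ring.
(* If [t * y = s], the cubic collapses to [y ^+ 2 * (y - 3)]; then [y = 3] and [v q = v t / 3],
   against [v t < v q]. *)
have tys : t * y != theta + q - 1.
  apply/negP => /eqP tys; have {}tys : t * y = s by rewrite tys; ring.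
  have cyE : potts_cubic theta q y = y ^+ 2 * (y - 3).
    have -> : q = t * y - t by rewrite tys; ring.
    by rewrite /potts_cubic; ring.
  move: cy => /eqP; rewrite cyE mulf_eq0 expf_eq0/= (negbTE y0) subr_eq0 => /eqP y3.
  have := congr1 v tys; rewrite y3 (uabsM vP) (uabs_uniformizer vP) s_abs.
  by pottslra.
split; last first.
  by apply/potts_fixed1P => //; rewrite -subr_eq0.
rewrite -subr_eq0 (_ : _ - 1 = t * y - (theta + q - 1)) ?subr_eq0//.
by rewrite /potts_fixed1; ring.
Qed.

(** * Expansion around the pole and a root of the cubic for [v q < 3^-1] *)

Section Repelling.
Hypothesis q_lt3 : v q < 3^-1.

Let q_le9 : v q <= 9^-1. Proof. exact: (uabs3_lt3V vP). Qed.

Local Ltac corelra := move: t_gt0 t_lt_q q_gt0 q_lt3 t_le q_le9; lra.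

Let core_sub1 x : v (x - pole) = v t / 3 -> v (x - 1) = v q.
Proof.
have -> : x - 1 = (x - pole) - s by rewrite sub_pole; ring.
by move=> xp; rewrite (@uabsDr _ _ _ _ vP (x - pole)) (uabsN vP) s_abs//; corelra.
Qed.

Let core_neq x : v (x - pole) = v t / 3 -> x != pole.
Proof. by move=> xp; rewrite -subr_eq0 -(uabs_gt0 vP) xp; corelra. Qed.

Let core_w x : v (x - pole) = v t / 3 -> v (w x) = 3 * v q.
Proof.
move=> xp; have := w_abs (core_neq xp); rewrite (core_sub1 xp) xp => wE.
by apply: (mulIf (lt0r_neq0 t_gt0)); lra.
Qed.

(** By [potts_deviationB] the deviation multiplies distances by [9 * v q / v t], and cubing divides
    them by 3; finally [v t <= v q / 3]. *)
Lemma potts_core_expand x x' y y' :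
  v (x - pole) = v t / 3 -> v (x' - pole) = v t / 3 ->
  f x = Some y -> f x' = Some y' -> 9 * v (x - x') <= v (y - y').
Proof.
move=> xp xp'; have xn := core_neq xp; have xn' := core_neq xp'.
rewrite !potts_betheE// => -[<-] [<-].
have w_le z : v z = 3 * v q -> v z <= 3^-1 by move=> ->; corelra.
rewrite (uabs3_cubeB vP (w_le _ (core_w xp)) (w_le _ (core_w xp'))).
have := congr1 v (potts_deviationB xn xn').
rewrite !(uabsM vP) xp xp' s_abs => e.
have dx0 := uabs_ge0 vP (x - x').
have {}e : v (w x - w x') * v t = 9 * v q * v (x - x').
  by apply: (mulIf (lt0r_neq0 t_gt0)); lra.
rewrite -(ler_pM2r t_gt0); have := ler_wpM2r dx0 t_le; lra.
Qed.

(** Distances grow by a factor 9 at each step, yet both orbits stay within [v t / 3] of the pole. *)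
Lemma potts_core_unique (u u' : nat -> K) :
  (forall n, f (u n) = Some (u n.+1)) -> (forall n, f (u' n) = Some (u' n.+1)) ->
  (forall n, v (u n - pole) = v t / 3) ->
  (forall n, v (u' n - pole) = v t / 3) -> u 0%N = u' 0%N.
Proof.
move=> uS uS' uA uA'; set d := u 0%N - u' 0%N.
have shrink n : v d <= 9^-1 ^+ n * v (u n - u' n).
  elim: n => [|n IHn]; first by rewrite expr0 mul1r.
  rewrite exprSr -mulrA (le_trans IHn)// ler_wpM2l ?exprn_ge0//.
  by have := potts_core_expand (uA n) (uA' n) (uS n) (uS' n); lra.
apply/eqP; rewrite -subr_eq0; apply: contraT; rewrite -(uabs_gt0 vP) -/d => d0.
have c0 : 0 <= 9^-1 :> R by lra.
have c1 : 9^-1 < 1 :> R by lra.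
have [n] := expr_lt_eps c0 c1 d0; rewrite ltNge => /negP[].
apply: (le_trans (shrink n)); rewrite ler_piMr ?exprn_ge0//.
have -> : u n - u' n = (u n - pole) - (u' n - pole) by ring.
by rewrite (uabs_leB vP) ?uA ?uA'//; corelra.
Qed.

(* Dividing the cubic by [y ^+ 2] turns its root of absolute value [1/3] into a
   fixed point of a contraction. *)
Definition cubic_iter y : K :=
  1 + theta + theta ^+ 2 - (2 * theta + 1) * (s / y) + (s / y) ^+ 2.

Let ball_abs y : v (y - 3) <= 9^-1 -> v y = 3^-1.
Proof.
move=> y3; rewrite -(subrK 3 y) (uabsDr vP) (uabs_uniformizer vP)//.
by apply: le_lt_trans y3 _; lra.
Qed.

Let ball_neq0 y : v (y - 3) <= 9^-1 -> y != 0.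
Proof. by move=> /ball_abs y3; rewrite -(uabs_gt0 vP) y3. Qed.

Lemma cubic_iter_fixed y : v (y - 3) <= 9^-1 -> cubic_iter y = y ->
  potts_cubic theta q y = 0.
Proof.
move=> /ball_neq0 y0 yE.
have : y ^+ 2 * (y - cubic_iter y) = potts_cubic theta q y.
  by rewrite /cubic_iter /potts_cubic; field.
by rewrite yE subrr mulr0.
Qed.

Let ball_ratio y : v (y - 3) <= 9^-1 -> v (s / y) <= 3^-1.
Proof.
move=> /ball_abs y3; rewrite (uabsM vP) (uabsV vP) y3 s_abs invrK.
corelra.
Qed.

Let v_2t3 : v (2 * theta + 1) <= 3^-1.
Proof.
have t3 : v t <= 3^-1 by corelra.
have -> : 2 * theta + 1 = 3 + (t + t) by ring.
by rewrite (uabs_leD vP) ?(uabs_uniformizer vP)// (uabs_leD vP).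
Qed.

Let vM9 x y : v x <= 3^-1 -> v y <= 3^-1 -> v (x * y) <= 9^-1.
Proof.
move=> x1 y1; rewrite (uabsM vP) (_ : 9^-1 = 3^-1 * 3^-1); last lra.
by rewrite ler_pM ?(uabs_ge0 vP).
Qed.

Lemma cubic_iter_ball y : v (y - 3) <= 9^-1 -> v (cubic_iter y - 3) <= 9^-1.
Proof.
move=> y3; have t3 : v t <= 3^-1 by corelra.
(* Each of the three products has two factors of absolute value at most [3^-1]. *)
have -> : cubic_iter y - 3 =
    t * (3 + t) - (2 * theta + 1) * (s / y) + (s / y) * (s / y).
  by rewrite /cubic_iter; ring.
rewrite (uabs_leD vP) ?(uabs_leB vP)// vM9 ?ball_ratio//.
by rewrite (uabs_leD vP) ?(uabs_uniformizer vP).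
Qed.

(** The difference factors: the first factor is at most [3^-1], the second is [9 * v q * v (y - z)],
    at most [v (y - z)] since [v q <= 9^-1]. *)
Lemma cubic_iter_contraction y z : v (y - 3) <= 9^-1 -> v (z - 3) <= 9^-1 ->
  v (cubic_iter y - cubic_iter z) <= 3^-1 * v (y - z).
Proof.
move=> y3 z3; have y0 := ball_neq0 y3; have z0 := ball_neq0 z3.
have -> : cubic_iter y - cubic_iter z =
    (s / y + s / z - (2 * theta + 1)) * (s * (z - y) * (y^-1 * z^-1)).
  by rewrite /cubic_iter; field; rewrite y0 z0.
rewrite (uabsM vP) ler_pM ?(uabs_ge0 vP)//.
  by rewrite (uabs_leB vP)// (uabs_leD vP) ?ball_ratio.
rewrite !(uabsM vP) !(uabsV vP) (ball_abs y3) (ball_abs z3) !invrK s_abs.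
rewrite -(opprB y z) (uabsN vP).
have := ler_wpM2r (uabs_ge0 vP (y - z)) q_le9; lra.
Qed.

End Repelling.

End PottsBetheDynamics.

Lemma padic_unramified (p : nat) (p_pr : prime p) :
  unramified_abs p (@padic_abs p p_pr).
Proof.
split.
- exact: padic_abs_ge0.
- exact: padic_abs_eq0E.
- exact: padic_absM.
- exact: padic_abs_leD.
- exact: padic_abs_lt_mul.
- exact: padic_abs_prime.
Qed.

(** * Basins and the cubic over [Q3] *)

Section PottsBetheQ3.
Variables (theta q : Q3).
Local Notation t := (theta - 1).
Local Notation pole := (potts_pole theta q).
Local Notation f := (potts_bethe theta q 3).
Local Notation poles := (\bigcup_n piter_preimage f n [set pole]).
Hypothesis t_gt0 : 0 < padic_abs t.
Hypothesis t_lt_q : padic_abs t < padic_abs q.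
Hypothesis q_lt1 : padic_abs q < 1.

Let vP := padic_unramified prime3.

Lemma potts_basin_sub_poles x : basin f 1 x -> ~ poles x.
Proof.
move=> [u /is_orbitP xu _]; apply: orbit_not_preimage xu.
exact: potts_bethe_pole.
Qed.

(** An orbit leaving the sphere converges to 1, so this one stays there and [potts_step_sphere]
    applies at every step. For [padic_abs q = 3^-1] this is a contradiction; below, it locates the
    exceptional point. *)
Lemma potts_basinN x : ~ poles x -> ~ basin f 1 x ->
  exists2 u, is_orbit f x u & padic_abs q < 3^-1 /\
    forall n, padic_abs (u n - pole) = padic_abs t / 3.
Proof.
move=> /(orbit_total (@potts_bethe_None _ _ _ 3))[u xu] xb; exists u => //.
have uS := xu.2.
have uq n : padic_abs (u n - 1) = padic_abs q.
  apply/eqP; apply: contra_notT xb.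
  move=> /(potts_orbit_near vP t_gt0 t_lt_q q_lt1 uS)[j uj].
  exists u; first exact/is_orbitP.
  apply/padic_cvgP => e e0.
  have c0 : 0 <= 3^-1 :> rat by [].
  have c1 : 3^-1 < 1 :> rat by [].
  have [N cN] := expr_lt_eps c0 c1 e0.
  exists (j + N)%N => m jm; apply: le_lt_trans cN.
  have jm' : (j <= m)%N by apply: leq_trans jm; exact: leq_addr.
  rewrite -(subnKC jm') (le_trans (uj _))// ler_wiXn2l ?(ltW c1)//.
  by rewrite leq_subRL.
have core n := potts_step_sphere vP t_gt0 t_lt_q q_lt1 (uS n) (uq n) (uq n.+1).
by split=> [|n]; [have [] := core 0%N|have [] := core n].
Qed.

Lemma potts_fixed_not_basin x : f x = Some x -> x != 1 -> ~ basin f 1 x.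
Proof.
move=> fx x1 [u /is_orbitP xu /padic_cvgP]; rewrite -subr_eq0 -(uabs_gt0 vP) in x1.
move=> /(_ _ x1)[N /(_ N (leqnn N))].
by rewrite (orbit_fixed fx xu) ltxx.
Qed.

Lemma potts_cubic_root : padic_abs q < 3^-1 ->
  exists y, potts_cubic theta q y = 0.
Proof.
move=> q3.
have c0 : 0 <= 3^-1 :> rat by [].
have c1 : 3^-1 < 1 :> rat by [].
have r0 : 0 < 9^-1 :> rat by [].
have [y y3 yE] := padic_contraction_fixpoint c0 c1 r0
  (cubic_iter_ball vP t_gt0 t_lt_q q3)
  (cubic_iter_contraction vP t_gt0 t_lt_q q3).
by exists y; exact: (cubic_iter_fixed vP y3 yE).
Qed.

End PottsBetheQ3.

Unset Implicit Arguments.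

Theorem theorem5p9 (R : realType) (theta q : Q3)
  (htheta : E3 R theta)
  (htheta0 : 0 < padic_abs (theta - 1))
  (hthetaq : padic_abs (theta - 1) < padic_abs q)
  (hq : padic_abs q < 1) :
  let f := potts_bethe theta q 3 in
  let poles := \bigcup_n piter_preimage f n [set potts_pole theta q] in
  (padic_abs q = 3^-1 -> basin f 1 = setT `\` poles) /\
  (padic_abs q < 3^-1 ->
    exists y1 : Q3, (forall y : Q3, potts_cubic theta q y = 0 <-> y = y1) /\
      basin f 1 = setT `\` ([set potts_fixed1 theta q y1] `|` poles)).
Proof.
move=> f poles; have vP := padic_unramified prime3.
split=> [q3|q3].
  apply/seteqP; split=> [x xb|x [_ xp]].
    by split=> //; exact: potts_basin_sub_poles xb.
  apply: contrapT => /(potts_basinN htheta0 hthetaq hq xp)[u _ []].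
  by rewrite q3 ltxx.
have [y1 cy1] := potts_cubic_root htheta0 hthetaq q3.
have fixed1 y : potts_cubic theta q y = 0 ->
    potts_fixed1 theta q y != 1 /\ f (potts_fixed1 theta q y) = Some (potts_fixed1 theta q y).
  exact: (cubic_root_fixed1 vP htheta0 hthetaq hq).
have core x : f x = Some x -> x != 1 ->
    padic_abs (x - potts_pole theta q) = padic_abs (theta - 1) / 3.
  by move=> fx x1; have [] := potts_fixed_sphere vP htheta0 hthetaq hq fx x1.
have [x1N1 fx1] := fixed1 y1 cy1; have x1_core := core _ fx1 x1N1.
(* Comparison with the constant orbit at the fixed point gives both the uniqueness of the root and
   the identification of the exceptional point. *)
have unique u uS uA := @potts_core_unique _ _ _ vP _ _ htheta0 hthetaq q3 u
  (fun=> potts_fixed1 theta q y1) uS (fun=> fx1) uA (fun=> x1_core).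
exists y1; split=> [y|].
  split=> [cy|->//]; have [xN1 fx] := fixed1 y cy; have x_core := core _ fx xN1.
  have := unique (fun=> potts_fixed1 theta q y) (fun=> fx) (fun=> x_core).
  move=> /=/(congr1 (fun x => x - potts_pole theta q)).
  (* Measured from the pole, [potts_fixed1] is multiplication by the nonzero [theta - 1], so equal
     fixed points come from equal roots. *)
  rewrite !potts_fixed1_sub_pole; apply: mulfI.
  by rewrite -(uabs_gt0 vP).
apply/seteqP; split=> [x xb|x [_ xp]].
  split=> // -[/= xE|]; last exact: potts_basin_sub_poles xb.
  by move: xb; rewrite xE; exact: potts_fixed_not_basin.
apply: contrapT => xb.
have [|u [u0 uS] [_ uA]] := potts_basinN htheta0 hthetaq hq _ xb.
  by move=> px; apply: xp; right.
by apply: xp; left; rewrite /= -u0; exact: unique uS uA.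
Qed.
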